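(* Let $\Delta$ be a $(d-1)$-dimensional flag complex with $\beta_{d-1}(\Delta) = a \geq 0$. Then the $f$-polynomial of $\Delta$ satisfies $f_{\Delta}(x) \geq (1 + (\sqrt[d]{a}+1)x)^d$, where $\geq$ denotes coefficient-wise inequality of real polynomials. Furthermore, if $\sqrt[d]{a}$ is an integer, then this inequality is tight, with equality holding if and only if $\Delta \cong \Delta(T_d(d(\sqrt[d]{a}+1)))$.
   Context: A flag complex is a (finite, non-empty) simplicial complex in which every set of pairwise adjacent vertices is a face. For a $(d-1)$-dimensional complex $\Delta$, $f_{\Delta}(x)=\sum_{i=0}^{d} f_{i-1}(\Delta)x^i$, where $f_{i-1}(\Delta)$ is the number of $(i-1)$-dimensional faces ($f_{-1}=1$). Fix a field $\Bbbk$; $\beta_k(\Delta)=\dim_{\Bbbk}\widetilde{H}_k(\Delta;\Bbbk)$. $T_d(n)$ is the Turán graph: the complete $d$-partite graph on $n$ vertices with parts of sizes $\lfloor n/d\rfloor$ or $\lceil n/d\rceil$; $\Delta(G)$ denotes the clique complex of a graph $G$. *)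

(* Defs.v *)
From HB Require Import structures.
From mathcomp Require Import all_boot all_order all_algebra.
From mathcomp Require Import reals exp.

Set Implicit Arguments.
Unset Strict Implicit.
Unset Printing Implicit Defensive.

Import Order.TTheory GRing.Theory Num.Theory.
Local Open Scope ring_scope.

(* A complex is given by its set of faces, the empty face included.  Its
   vertices are the v with [set v] a face; the ambient type V may contain
   further points. *)
Definition simplicial_complex (V : finType) (D : {set {set V}}) : Prop :=
  set0 \in D /\ (forall S T : {set V}, S \in D -> T \subset S -> T \in D).

(* The case u = v of the hypothesis says that the elements of S are vertices. *)
Definition flag_complex (V : finType) (D : {set {set V}}) : Prop :=
  simplicial_complex D /\
  (forall S : {set V}, {in S &, forall u v, [set u; v] \in D} -> S \in D).

Definition vertices (V : finType) (D : {set {set V}}) : {set V} :=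
  [set v | [set v] \in D].

(* Faces with i vertices, i.e. of dimension i - 1. *)
Definition faces (V : finType) (D : {set {set V}}) (i : nat) : {set {set V}} :=
  [set S in D | #|S| == i].

Definition max_card (V : finType) (D : {set {set V}}) : nat :=
  (\max_(S in D) #|S|)%N.

Definition complex_dim (V : finType) (D : {set {set V}}) : int :=
  (max_card D)%:Z - 1.

Definition f_poly (R : nzRingType) (V : finType) (D : {set {set V}}) :
    {poly R} :=
  \sum_(i < (max_card D).+1) #|faces D i|%:R *: 'X^i.

Definition coef_le (R : numDomainType) (p q : {poly R}) : Prop :=
  forall i : nat, p`_i <= q`_i.

(* Faces are oriented by the enumeration order of V: face_pos S v is the
   position of v in S, counted from 0. *)
Definition face_pos (V : finType) (S : {set V}) (v : V) : nat :=
  #|[set u in S | (enum_rank u < enum_rank v)%N]|.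

(* Matrix, acting on row vectors, of the boundary map from k-chains to
   (k-1)-chains,  S |-> \sum_(v in S) (-1)^(position of v in S) (S \ v).
   For k = 0 the target is spanned by the empty face, so the resulting
   homology is the reduced one. *)
Definition boundary (F : fieldType) (V : finType) (D : {set {set V}})
    (k : nat) : 'M[F]_(#|faces D k.+1|, #|faces D k|) :=
  \matrix_(i, j)
    let S : {set V} := enum_val i in let T : {set V} := enum_val j in
    \sum_(v in S | S :\ v == T) (-1) ^+ face_pos S v.

(* Dimension of the cycles minus dimension of the boundaries, for k >= 0;
   boundaries_sub_cycles below shows that the subtraction is not truncated. *)
Definition betti (F : fieldType) (V : finType) (D : {set {set V}})
    (k : nat) : nat :=
  (\rank (kermx (boundary F D k)) - \rank (boundary F D k.+1))%N.

Definition complex_iso (V W : finType) (D : {set {set V}})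
    (E : {set {set W}}) : Prop :=
  exists2 f : V -> W,
    {in vertices D &, injective f} & [set f @: S | S : {set V} in D] = E.

Definition clique_complex (V : finType) (e : rel V) : {set {set V}} :=
  [set S : {set V} | [forall u in S, forall v in S, (u != v) ==> e u v]].

(* The parts are the residue classes mod d; their sizes are computed in
   card_turan_part below. *)
Definition turan_graph (d n : nat) : rel 'I_n :=
  fun i j => (i %% d != j %% d)%N.
Arguments turan_graph : clear implicits.

Lemma card_turan_part (d n j : nat) : (j < d)%N ->
  #|[set i : 'I_n | i %% d == j]%N| = (n %/ d + (j < n %% d))%N.
Proof.
move=> jd; have d0 : (0 < d)%N by exact: leq_ltn_trans jd.
rewrite -sum1_card (eq_bigl (fun i : 'I_n => i %% d == j)%N); last first.
  by move=> i; rewrite inE.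
rewrite big_mkcond /=.
elim: n => [|n IHn]; first by rewrite big_ord0 div0n mod0n.
rewrite big_ord_recr /= {}IHn.
have rd := ltn_pmod n d0.
have -> : n.+1 = (n %/ d * d + (n %% d).+1)%N by rewrite addnS -divn_eq.
move: (n %/ d)%N (n %% d)%N rd => q r rd.
rewrite divnMDl // modnMDl.
case: (ltngtP r.+1 d) rd => // [rd _|rd _].
  rewrite divn_small // modn_small // addn0 ltnS -addnA; congr (_ + _)%N.
  by case: ltngtP.
rewrite rd divnn modnn d0 ltn0 addn0 -addnA; congr (_ + _)%N.
by move: jd; rewrite -rd ltnS; case: ltngtP.
Qed.

Lemma flag_clique_complex (V : finType) (e : rel V) :
  symmetric e -> flag_complex (clique_complex e).
Proof.
move=> esym; split; first split.
- by rewrite inE; apply/forall_inP => u; rewrite inE.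
- move=> S T; rewrite !inE => /forall_inP SP /subsetP TS.
  apply/forall_inP => u uT; apply/forall_inP => v vT.
  by have /forall_inP := SP u (TS u uT); apply; apply: TS.
- move=> S SP; rewrite inE.
  apply/forall_inP => u uS; apply/forall_inP => v vS.
  have := SP u v uS vS; rewrite inE => /forall_inP /(_ u).
  by rewrite !inE eqxx => /(_ isT) /forall_inP /(_ v); rewrite !inE eqxx orbT; apply.
Qed.

Lemma face_posD1 (V : finType) (S : {set V}) (v w : V) : v \in S ->
  face_pos S w = (face_pos (S :\ v) w + (enum_rank v < enum_rank w))%N.
Proof.
move=> vS; rewrite /face_pos (cardsD1 v) inE vS /= addnC; congr (_ + _)%N.
by apply: eq_card => u; rewrite !inE andbA.
Qed.

Lemma boundaryK (F : fieldType) (V : finType) (D : {set {set V}}) (k : nat) :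
  simplicial_complex D -> boundary F D k.+1 *m boundary F D k = 0.
Proof.
move=> [_ Dsub]; apply/matrixP => i j; rewrite !mxE.
set S : {set V} := enum_val i; set U : {set V} := enum_val j.
have : S \in faces D k.+2 by exact: enum_valP.
rewrite inE => /andP[SD /eqP Sk].
pose t (v w : V) : F := (-1) ^+ face_pos S v * (-1) ^+ face_pos (S :\ v) w.
pose B (T : {set V}) : F := \sum_(w in T | T :\ w == U) (-1) ^+ face_pos T w.
pose lt (v w : V) := (enum_rank v < enum_rank w)%N.
pose P v w := [&& v \in S, w \in S, v != w & S :\ v :\ w == U].
transitivity (\sum_v \sum_(w | P v w) t v w).
  transitivity (\sum_(v in S) (-1) ^+ face_pos S v * B (S :\ v)).
    rewrite (partition_big (fun v => S :\ v) [in faces D k.+1]) /=; last first.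
      move=> v vS; rewrite inE (Dsub S) ?subsetDl //=.
      by move: Sk; rewrite (cardsD1 v) vS add1n => -[->].
    rewrite [RHS]big_enum_val /=; apply: eq_bigr => m _; rewrite !mxE /=.
    rewrite mulr_suml; apply: eq_bigr => v /andP[_ /eqP ->].
    by [].
  rewrite big_mkcond /=; apply: eq_bigr => v _; case: ifP => vS; last first.
    by rewrite big_pred0 // => w; rewrite /P vS.
  rewrite /B mulr_sumr; apply: eq_bigl => w.
  by rewrite /P vS !inE (eq_sym v) [(w != v) && _]andbC -andbA.
have tN v w : v \in S -> w \in S -> lt v w -> t w v = - t v w.
  move=> vS wS vw; rewrite /t (face_posD1 w vS) (face_posD1 v wS).
  rewrite /lt in vw; rewrite vw ltnNge (ltnW vw) /= addn0 addn1 exprS.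
  by rewrite mulN1r mulNr mulrC.
have split v : \sum_(w | P v w) t v w =
    \sum_(w | P v w && lt v w) t v w + \sum_(w | P v w && lt w v) t v w.
  rewrite (bigID (lt v)) /=; congr (_ + _); apply: eq_bigl => w.
  rewrite /P /lt; case: (v =P w) => [->|/eqP vw]; first by rewrite !andbF.
  by rewrite -leqNgt leq_eqVlt (inj_eq val_inj) (inj_eq enum_rank_inj)
    (eq_sym w) (negbTE vw).
rewrite (eq_bigr _ (fun v _ => split v)) big_split /=.
rewrite [X in _ + X](exchange_big_dep xpredT) //= -big_split /=.
apply: big1 => v _.
have PC w : P w v = P v w.
  by rewrite /P andbCA eq_sym !setDDl setUC.
rewrite [X in _ + X](eq_bigl (fun w => P v w && lt v w)) => [|w]; last first.
  by rewrite PC.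
rewrite -big_split big1 //= => w /andP[/and4P[vS wS _ _] vw].
by rewrite (tN v w) // subrr.
Qed.

Lemma boundaries_sub_cycles (F : fieldType) (V : finType) (D : {set {set V}})
    (k : nat) :
  simplicial_complex D -> (boundary F D k.+1 <= kermx (boundary F D k))%MS.
Proof. by move=> Dsc; apply/sub_kermxP; exact: boundaryK. Qed.

(* Main.v *)
(* Let v be a vertex whose link B has the largest top Betti number b among all
   vertex links.  B is an induced subcomplex, as the complex is flag, and
   deleting the t non-neighbours of v other than v itself leaves the cone over B,
   which has no top cycles.  Each deletion of a vertex w lowers the top Betti
   number by at most that of the current link of w, so a <= t b, and it lowers
   the f-polynomial by x times that of this link, bounded below by induction.
   With s ^ (d - 1) = b this gives at least the coefficients of
   (1 + (s + 1) x) ^ (d - 1) (1 + (a / b + 1) x), and AM-GM concludes.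
   If a = m ^ d, counting vertices already forces s = t = m in the extremal
   case; varying the order of deletion shows that the non-neighbours of v are
   pairwise non-adjacent and joined to all of B, which is a Turan complex by
   induction. *)

Require Import Defs.
From HB Require Import structures.
From mathcomp Require Import all_boot all_order all_algebra.
From mathcomp Require Import reals exp.
From mathcomp Require Import ring lra zify.

Set Implicit Arguments.
Unset Strict Implicit.
Unset Printing Implicit Defensive.

Import Order.TTheory GRing.Theory Num.Theory.
Local Open Scope ring_scope.

(** * Chains *)

Section Chains.
Variables (F : fieldType) (V : finType).
Implicit Types (v w : V) (S T : {set V}) (K L : {set {set V}}) (k : nat).

(* Chains are functions on all subsets of V, in all degrees at once, so that a
   complex, its deletions and its links share one ambient vector space. *)
Local Notation chain := {ffun {set V} -> F^o}.
Implicit Types z : chain.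

Definition face_sign T v : F := (-1) ^+ face_pos T v.

Lemma face_pos_setU1 T v w : v \notin T ->
  face_pos (v |: T) w = (face_pos T w + (enum_rank v < enum_rank w))%N.
Proof. by move=> vT; rewrite (@face_posD1 _ _ v) ?setU11 ?setU1K. Qed.

Lemma face_pos_setU1_id T v : face_pos (v |: T) v = face_pos T v.
Proof.
by apply: eq_card => u; rewrite !inE; case: eqVneq => // ->;
  rewrite ltnn !andbF.
Qed.

(** Whichever of [v], [w] has the smaller rank shifts the position of the other by one, and not
    conversely. *)
Lemma face_sign_swap T v w : v != w -> v \notin T -> w \notin T ->
  face_sign T w * face_sign (w |: T) v =
  - (face_sign T v * face_sign (v |: T) w).
Proof.
move=> vw vT wT; rewrite /face_sign -!exprD !face_pos_setU1 // addnA.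
rewrite [(face_pos T v + _)%N]addnA [(face_pos T w + _)%N]addnC.
have : (enum_rank v != enum_rank w :> nat).
  by rewrite (inj_eq val_inj) (inj_eq enum_rank_inj).
by case: ltngtP => //= _ _; rewrite addn0 addn1 exprS mulN1r ?opprK.
Qed.

Lemma face_sign_sq T v : face_sign T v * face_sign T v = 1.
Proof. by rewrite /face_sign -exprD addnn -mul2n exprM sqrrN expr1n expr1n. Qed.

(** The simplicial boundary read coefficientwise: [face_sign T v] is also the sign of [v] inside
    [v |: T], by [face_pos_setU1_id]. *)
Definition bd z : chain :=
  [ffun T : {set V} => \sum_(v | v \notin T) face_sign T v * z (v |: T)].

Definition contract v z : chain :=
  [ffun T : {set V} => if v \in T then 0 else face_sign T v * z (v |: T)].

Definition cone v z : chain :=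
  [ffun T : {set V} => if v \in T then face_sign T v * z (T :\ v) else 0].

(** A linear map whose kernel is the space of chains supported on [K]. *)
Definition off K z : chain := [ffun S : {set V} => if S \in K then 0 else z S].

Fact bd_linear : linear bd.
Proof.
move=> a z z'; apply/ffunP => T; rewrite !ffunE scaler_sumr -big_split /=.
by apply: eq_bigr => v _; rewrite !ffunE mulrDr; congr (_ + _); apply: mulrCA.
Qed.

Fact contract_linear v : linear (contract v).
Proof.
move=> a z z'; apply/ffunP => T; rewrite !ffunE; case: ifP => _.
  by rewrite scaler0 addr0.
by rewrite mulrDr; congr (_ + _); apply: mulrCA.
Qed.

Fact off_linear K : linear (off K).
Proof.
by move=> a z z'; apply/ffunP => T; rewrite !ffunE; case: ifP;
  rewrite ?scaler0 ?addr0.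
Qed.

HB.instance Definition _ :=
  GRing.isLinear.Build F chain chain _ bd bd_linear.
HB.instance Definition _ v :=
  GRing.isLinear.Build F chain chain _ (contract v) (contract_linear v).
HB.instance Definition _ K :=
  GRing.isLinear.Build F chain chain _ (off K) (off_linear K).

(** Up to sign, contraction is a chain map towards the link: the term [w = v] vanishes and every
    other one is a swap of signs. *)
Lemma bd_contract v z : bd (contract v z) = - contract v (bd z).
Proof.
apply/ffunP => T; rewrite !ffunE; have [vT|vT] := boolP (v \in T).
  by rewrite oppr0 big1 // => w wT; rewrite ffunE inE vT orbT mulr0.
rewrite mulr_sumr (bigD1 v vT) /= ffunE setU11 mulr0 add0r -sumrN.
apply: eq_big => [w|w /andP[wT wv]]; first by rewrite !inE negb_or andbC.
rewrite ffunE !inE eq_sym (negbTE wv) (negbTE vT) !mulrA.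
by rewrite face_sign_swap 1?eq_sym // setUCA mulNr.
Qed.

(** [cone v] is a contracting homotopy on all chains, even those that meet [v]: for [v \in T] the
    term [v] of [bd z] at [T :\ v] cancels [z T]. *)
Lemma bd_cone v z : bd (cone v z) = z - cone v (bd z).
Proof.
apply/ffunP => T; rewrite !ffunE; have [vT|vT] := boolP (v \in T); last first.
  rewrite oppr0 addr0 (bigD1 v vT) /= big1 => [|w /andP[wT wv]].
    rewrite ffunE setU11 setU1K // /face_sign face_pos_setU1_id.
    by rewrite -/(face_sign _ _) mulrA face_sign_sq mul1r addr0.
  by rewrite ffunE !inE eq_sym (negbTE wv) (negbTE vT) mulr0.
have TE : T = v |: (T :\ v) by rewrite setD1K.
rewrite mulr_sumr [in RHS](bigD1 v) /= ?setD11 // -TE opprD addrA mulrA.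
have -> : face_sign T v = face_sign (T :\ v) v.
  by rewrite {1}TE /face_sign face_pos_setU1_id.
rewrite face_sign_sq mul1r subrr add0r -sumrN; apply: eq_big => [w|w wT].
  by rewrite !inE; case: (w =P v) => [->|]; rewrite ?vT ?andbF ?andbT.
have wv : w != v by apply: contraNneq wT => ->.
have wT' : w \notin T :\ v by rewrite !inE (negbTE wT) andbF.
rewrite ffunE !inE vT orbT !mulrA.
have -> : (w |: T) :\ v = w |: (T :\ v).
  by rewrite setDUl; congr (_ :|: _); apply/setDidPl; rewrite disjoints1 inE.
rewrite -!mulNr; congr (_ * _).
have -> : face_sign (w |: T) v = face_sign (w |: (T :\ v)) v.
  by rewrite {1}TE setUCA /face_sign face_pos_setU1_id.
have := @face_sign_swap (T :\ v) v w;
  rewrite -TE setD11 eq_sym wv => /(_ isT isT wT').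
move: (face_sign_sq (T :\ v) v) (face_sign_sq (w |: (T :\ v)) v).
move: (face_sign (T :\ v) w) (face_sign (T :\ v) v) (face_sign (w |: _) v).
move=> a c b cc bb E.
have -> : face_sign T w = - (a * b) * c.
  by rewrite E opprK mulrAC cc mul1r.
by rewrite -mulrA [c * b]mulrC mulrA !mulNr -[a * b * b]mulrA bb mulr1 mulrC.
Qed.

(** [k] counts vertices, so these cycles have dimension [k - 1]; for [k = 0] they live on the empty
    face. *)
Definition cycles K k : {vspace chain} :=
  (lker (linfun (off (faces K k))) :&: lker (linfun bd))%VS.

Lemma cyclesP K k z :
  reflect ((forall S, S \notin faces K k -> z S = 0) /\ bd z = 0)
          (z \in cycles K k).
Proof.
rewrite memv_cap !memv_ker !lfunE /=; apply: (iffP andP) => -[zK /eqP bz].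
  split=> // S SK; move/eqP/ffunP/(_ S): zK; rewrite !ffunE (negbTE SK) //.
split=> //; apply/eqP/ffunP => S; rewrite !ffunE.
by case: ifPn => // /zK.
Qed.

Lemma dim_cycles_le_card K k : (\dim (cycles K k) <= #|faces K k|)%N.
Proof.
pose delta S : chain := [ffun T : {set V} => (T == S)%:R].
rewrite cardE -(size_map delta); apply: leq_trans (dim_span _); apply: dimvS.
apply/subvP => z /cyclesP[zK _].
have -> : z = \sum_(S in faces K k) z S *: delta S.
  apply/ffunP => T; rewrite sum_ffunE; have [TK|TK] := boolP (T \in faces K k).
    rewrite (bigD1 T) //= !ffunE eqxx big1 ?addr0; first by symmetry;
      apply: mulr1.
    by move=> S /andP[_ ST]; rewrite !ffunE eq_sym (negbTE ST) scaler0.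
  rewrite zK // big1 // => S SK; rewrite !ffunE; case: eqP => [E|];
    last by rewrite scaler0.
  by rewrite E SK in TK.
apply: memv_suml => S SK; apply: memvZ; apply: memv_span; apply: map_f.
by rewrite mem_enum.
Qed.

Lemma dim_cycles_mono K L k : K \subset L ->
  (\dim (cycles K k) <= \dim (cycles L k))%N.
Proof.
move=> /subsetP KL; apply: dimvS; apply/subvP => z /cyclesP[zK bz].
by apply/cyclesP; split=> // S SL; apply: zK; apply: contra SL;
  rewrite !inE => /andP[/KL ->].
Qed.

End Chains.

(** * Clique complexes *)

Section Cliques.
Variables (F : fieldType) (V : finType) (e : rel V).
Hypothesis e_sym : symmetric e.
Implicit Types (v w : V) (S T A B : {set V}) (k : nat).

(** The guard [u != v] matters because [edge] below is reflexive at vertices. *)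
Definition nb v : {set V} := [set u | (u != v) && e v u].

(** Induced subcomplexes are named by vertex sets: deleting [v] gives [A :\ v], and its link is on
    [A :&: nb v]. *)
Definition cliques A : {set {set V}} :=
  [set S in clique_complex e | S \subset A].

Definition nface A k : nat := #|faces (cliques A) k|.

(* If A has no clique with k + 1 elements, this is the Betti number in dimension
   k - 1 of the clique complex. *)
Definition dcyc A k : nat := \dim (cycles F (cliques A) k).

Lemma cliquesP A S :
  reflect (S \subset A /\ {in S &, forall u v, u != v -> e u v})
          (S \in cliques A).
Proof.
rewrite !inE andbC; apply: (iffP andP) => -[SA SC]; split=> //.
  move=> u v uS vS; apply/implyP.
  by move/forall_inP: SC => /(_ u uS)/forall_inP/(_ v vS).
by apply/forall_inP => u uS; apply/forall_inP => v vS; apply/implyP; apply: SC.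
Qed.

(** Links in clique complexes are induced: a clique extends by [v] as soon as each of its elements
    is adjacent to [v]. *)
Lemma cliques_setU1 A T v : v \notin T ->
  (v |: T \in cliques A) = (v \in A) && (T \in cliques (A :&: nb v)).
Proof.
move=> vT; apply/cliquesP/andP => [[]|[vA /cliquesP[]]].
  rewrite subUset sub1set => /andP[vA TA] cl; split=> //; apply/cliquesP; split.
    apply/subsetP => u uT; rewrite !inE (subsetP TA) //=.
    have uv : u != v by apply: contraNneq vT => <-.
    by rewrite uv cl ?setU11 // 1?eq_sym // setU1r.
  by move=> u w uT wT; apply: cl; apply: setU1r.
rewrite subsetI => /andP[TA /subsetP Tv] cl; split;
  first by rewrite subUset sub1set vA.
have vu u : u \in T -> e v u by move/Tv; rewrite inE => /andP[].
move=> u w /setU1P[->|uT] /setU1P[->|wT]; rewrite ?eqxx // => uw.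
- exact: vu.
- by rewrite e_sym vu.
- exact: cl.
Qed.

Lemma faces_cliques_setU1 A T v k : v \notin T ->
  (v |: T \in faces (cliques A) k.+1) =
  (v \in A) && (T \in faces (cliques (A :&: nb v)) k).
Proof.
by move=> vT; rewrite [LHS]inE [in RHS]inE cliques_setU1 // cardsU1 vT add1n eqSS andbA.
Qed.

Lemma faces_cliquesD1 A T v k : v \notin T ->
  (T \in faces (cliques (A :\ v)) k) = (T \in faces (cliques A) k).
Proof.
by move=> vT; rewrite !inE subsetD1 vT andbT.
Qed.

Lemma faces_cliques_sub A S k : S \in faces (cliques A) k -> S \subset A.
Proof. by rewrite inE => /andP[/cliquesP[]]. Qed.

Lemma cliques_mono A B : A \subset B -> cliques A \subset cliques B.
Proof.
move=> AB; apply/subsetP => S; rewrite !inE => /andP[-> SA].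
exact: subset_trans AB.
Qed.

Lemma faces_cliques_mono A B k :
  A \subset B -> faces (cliques A) k \subset faces (cliques B) k.
Proof.
move=> /cliques_mono/subsetP AB; apply/subsetP => S.
by rewrite ![S \in faces _ _]inE => /andP[/AB -> ->].
Qed.

Lemma dcyc_mono A B k : A \subset B -> (dcyc A k <= dcyc B k)%N.
Proof. by move=> AB; apply/dim_cycles_mono/cliques_mono. Qed.

Lemma nface_mono A B k : A \subset B -> (nface A k <= nface B k)%N.
Proof. by move=> AB; apply/subset_leq_card/faces_cliques_mono. Qed.

Lemma dcyc_le_nface A k : (dcyc A k <= nface A k)%N.
Proof. exact: dim_cycles_le_card. Qed.

Lemma nface0 A : nface A 0 = 1%N.
Proof.
rewrite /nface (_ : faces _ _ = [set set0]) ?cards1 //; apply/setP => S.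
rewrite in_set1 [LHS]inE cards_eq0 andbC; case: eqP => //= ->.
by apply/cliquesP; split; rewrite ?sub0set // => u v; rewrite inE.
Qed.

Lemma nfaceS A v k : v \in A ->
  nface A k.+1 = (nface (A :\ v) k.+1 + nface (A :&: nb v) k)%N.
Proof.
move=> vA; rewrite /nface -(cardsID [set S : {set V} | v \in S]) addnC;
  congr (_ + _)%N.
  apply: eq_card => S; rewrite in_setD in_set.
  have [vS|vS] := boolP (v \in S); last by rewrite faces_cliquesD1.
  symmetry; apply/negbTE; apply/negP => /faces_cliques_sub.
  by move/subsetP/(_ v vS); rewrite setD11.
rewrite -[RHS](card_in_imset (f := fun T : {set V} => v |: T)); last first.
  move=> S T /faces_cliques_sub/subsetP Sv /faces_cliques_sub/subsetP Tv.
  have vS : v \notin S by apply/negP => /Sv; rewrite !inE eqxx andbF.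
  have vT : v \notin T by apply/negP => /Tv; rewrite !inE eqxx andbF.
  by move=> E; rewrite -(setU1K vS) E setU1K.
apply: eq_card => S; rewrite in_setI (in_set (fun S : {set V} => v \in S));
  apply/andP/imsetP.
  move=> [SA vS]; exists (S :\ v); last by rewrite setD1K.
  by move: SA; rewrite -{1}(setD1K vS) faces_cliques_setU1 ?setD11 // vA.
move=> [T TK ->]; rewrite setU11; split=> //.
rewrite faces_cliques_setU1 ?vA //; apply/negP.
by move/(subsetP (faces_cliques_sub TK)); rewrite !inE eqxx andbF.
Qed.

Lemma nface_set0 k : nface set0 k.+1 = 0%N.
Proof.
apply/eqP; rewrite cards_eq0; apply/eqP/setP => S; rewrite in_set0; apply/negP.
by rewrite inE => /andP[/cliquesP[]]; rewrite subset0 => /eqP ->;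
  rewrite cards0.
Qed.

Lemma nface1 A : nface A 1 = #|A|.
Proof.
move: {2}#|A| (erefl #|A|) => n; elim: n A => [|n IHn] A An.
  by move/eqP: An; rewrite cards_eq0 => /eqP ->; rewrite nface_set0 cards0.
have /card_gt0P[v vA] : (0 < #|A|)%N by rewrite An.
have := cardsD1 v A; rewrite vA An add1n => -[An'].
by rewrite (nfaceS _ vA) nface0 IHn -?An' // addn1.
Qed.

(** Rank-nullity for [contract v] on cycles: its kernel consists of cycles that avoid [v], its image
    of cycles of the link. *)
Lemma dcycS A v k : v \in A ->
  (dcyc A k.+1 <= dcyc (A :\ v) k.+1 + dcyc (A :&: nb v) k)%N.
Proof.
move=> vA; rewrite /dcyc.
rewrite -(limg_ker_dim (linfun (contract v)) (cycles F (cliques A) k.+1)).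
apply: leq_add; apply: dimvS; apply/subvP => z.
  rewrite memv_cap memv_ker lfunE /= => /andP[/cyclesP[zK bz] /eqP cz].
  apply/cyclesP; split=> // S SK; have [vS|vS] := boolP (v \in S); last first.
    by apply: zK; rewrite -(faces_cliquesD1 _ _ vS).
  have /ffunP/(_ (S :\ v)) := cz; rewrite !ffunE setD11 setD1K // => /eqP.
  by rewrite mulf_eq0 signr_eq0 => /eqP.
case/memv_imgP => y /cyclesP[yK by0] ->; rewrite lfunE /=; apply/cyclesP; split.
  move=> T TK; rewrite ffunE; case: ifPn => // vT.
  by rewrite yK ?mulr0 // faces_cliques_setU1 // vA.
by rewrite bd_contract by0 linear0 oppr0.
Qed.

(** All faces with [k] elements contain [v], so the boundary of a cycle [z] at [S :\ v] has the
    single term [z S], up to sign. *)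
Lemma dcyc_cone A v k : nface A k = 0%N -> dcyc (v |: A) k = 0%N.
Proof.
move=> A0; apply/eqP; rewrite dimv_eq0 -subv0; apply/subvP => z /cyclesP[zK bz].
rewrite memv0; apply/eqP/ffunP => S; rewrite [RHS]ffunE.
have [SK|/zK //] := boolP (S \in faces (cliques (v |: A)) k).
have zv T : v \notin T -> z T = 0.
  move=> vT; apply: zK; rewrite -(faces_cliquesD1 _ _ vT).
  have : (nface ((v |: A) :\ v) k <= nface A k)%N.
    by apply: nface_mono; rewrite setDUl setDv set0U subsetDl.
  rewrite A0 leqn0 cards_eq0 => /eqP ->; by rewrite in_set0.
have [vS|/zv //] := boolP (v \in S).
have /ffunP/(_ (S :\ v)) := bz; rewrite !ffunE (bigD1 v) ?setD11 //= setD1K //.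
rewrite big1 ?addr0 => [|w /andP[_ wv]];
  last by rewrite zv ?mulr0 // !inE [v == w]eq_sym (negbTE wv) eqxx.
by move=> /eqP; rewrite mulf_eq0 signr_eq0 => /eqP.
Qed.

(* If w is joined to the link of v, any cycle z of that link extends to the
   cycle cone v z - cone w z of A, which contracts back to z. *)
Lemma dcyc_join A v w k : v \in A -> w \in A -> v != w ->
    A :&: nb v \subset nb w ->
  (dcyc (A :\ v) k.+1 + dcyc (A :&: nb v) k <= dcyc A k.+1)%N.
Proof.
move=> vA wA vw vsub.
rewrite [X in (_ <= X)%N]/dcyc.
rewrite -(limg_ker_dim (linfun (contract v)) (cycles F (cliques A) k.+1)).
apply: leq_add; apply: dimvS; apply/subvP => z /cyclesP[zK bz].
  rewrite memv_cap memv_ker lfunE /=; apply/andP; split.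
    apply/cyclesP; split=> // S SK; apply: zK; apply: contra SK.
    by rewrite !inE subsetD1 => /andP[/andP[-> /andP[->]]].
  apply/eqP/ffunP => T; rewrite !ffunE; case: ifPn => // vT.
  by rewrite zK ?mulr0 //;
    apply/negP => /faces_cliques_sub/subsetP/(_ v (setU11 _ _));
    rewrite setD11.
have zv T : v \in T -> z T = 0.
  move=> vT; apply: zK; apply/negP => /faces_cliques_sub/subsetP/(_ v vT).
  by rewrite !inE eqxx andbF.
have cK u : u \in A -> A :&: nb v \subset nb u ->
    forall S, S \notin faces (cliques A) k.+1 -> cone u z S = 0.
  move=> uA vu S SK; rewrite ffunE; case: ifP => // uS.
  rewrite zK ?mulr0 //; apply: contra SK => SK.
  rewrite -(setD1K uS) faces_cliques_setU1 ?setD11 // uA /=.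
  by apply: subsetP SK; apply: faces_cliques_mono; rewrite subsetI subsetIl.
have c0 u : cone u (0 : {ffun {set V} -> F^o}) = 0.
  by apply/ffunP => T; rewrite !ffunE mulr0 if_same.
have -> : z = linfun (contract v) (cone v z - cone w z).
  rewrite lfunE /=; apply/ffunP => T; rewrite !ffunE; case: ifPn => [/zv //|vT].
  rewrite setU11 setU1K // (_ : (if _ then _ else _) = 0) ?subr0; last first.
    by case: ifP => // _; rewrite zv ?mulr0 // !inE vw eqxx.
  by rewrite /face_sign face_pos_setU1_id -/(face_sign _ _ _) mulrA face_sign_sq mul1r.
apply: memv_img; apply/cyclesP; split.
  move=> S SK; have := cK v vA (subsetIr _ _) S SK.
  by have := cK w wA vsub S SK; rewrite !ffunE => -> ->; rewrite subrr.
by rewrite linearB /= !bd_cone bz !c0 !subr0 subrr.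
Qed.

End Cliques.

(** * Real inequalities *)

Section Inequalities.
Variable R : realFieldType.
Implicit Types (x y r s t : R) (d i j k m n : nat).

(** For [y >= 0] both factors have the same sign. *)
Lemma exprB1_mul_ge0 n y : 0 <= y -> 0 <= (y ^+ n - 1) * (y - 1).
Proof.
move=> y0; elim: n => [|n IHn]; first by rewrite subrr mul0r.
have -> : (y ^+ n.+1 - 1) * (y - 1) = y * ((y ^+ n - 1) * (y - 1)) + (y - 1) ^+ 2.
  by rewrite exprS; ring.
by apply: addr_ge0 (sqr_ge0 _); apply: mulr_ge0.
Qed.

(** The left side telescopes into the terms [y^i (y - 1)] with [i < j], each at most
    [y^(j + k) (y - 1)]. *)
Lemma exprB1_le j k y : 0 <= y -> y ^+ j - 1 <= j%:R * (y ^+ (j + k) * (y - 1)).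
Proof.
move=> y0; elim: j k => [|j IHj] k; first by rewrite mul0r subrr.
have := mulr_ge0 (exprn_ge0 j y0) (exprB1_mul_ge0 k.+1 y0).
have := IHj k.+1; rewrite addSnnS exprD -natr1 [y ^+ j.+1]exprS.
move: (y ^+ j) (y ^+ k.+1) (j%:R : R) => a b c; nra.
Qed.

(** AM-GM for [j] copies of [y^(j + k)] and [k] copies of 1, free of roots. *)
Lemma weighted_agm j k y :
  0 <= y -> (j + k)%:R * y ^+ j <= k%:R + j%:R * y ^+ (j + k).
Proof.
move=> y0; elim: k => [|k IHk]; first by rewrite addn0 add0r.
have := exprB1_le j k y0; rewrite addnS exprS -!natr1.
by move: IHk; move: (y ^+ (j + k)) => a; nra.
Qed.

(** Bernoulli's inequality with a square to spare, which settles the equality case in [agm_eq]. *)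
Lemma bernoulli_gap d y : 0 <= y ->
  d.+2%:R * y + (y - 1) ^+ 2 <= d.+1%:R + y ^+ d.+2.
Proof.
move=> y0; elim: d => [|d IHd]; first by rewrite le_eqVlt; apply/orP; left;
  apply/eqP; ring.
have := exprB1_mul_ge0 d.+2 y0;
  rewrite [y ^+ d.+3]exprS -[d.+3%:R]natr1 -[in X in _ -> _ <= X + _]natr1.
by move: IHd; move: (y ^+ d.+2) => a; nra.
Qed.

(** AM-GM for [d] copies of [s] and one [t]: [weighted_agm] at [y = r / s], scaled by [s]. *)
Lemma agm d r s t : 0 <= r -> 0 < s -> r ^+ d.+1 <= s ^+ d * t ->
  d.+1%:R * r <= d%:R * s + t.
Proof.
move=> r0 s0 rst; have := weighted_agm 1 d (divr_ge0 r0 (ltW s0)).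
rewrite expr1 mul1r add1n => /(ler_wpM2r (ltW s0)).
rewrite -mulrA divfK ?gt_eqF // mulrDl => /le_trans; apply; rewrite lerD2l.
rewrite exprMn exprVn exprSr [s ^+ d.+1]exprSr invfM -!mulrA mulVf ?gt_eqF // mulr1.
by rewrite mulrA -exprSr ler_pdivrMr ?exprn_gt0 // mulrC.
Qed.

(** The slack [(r / s - 1)^2] of [bernoulli_gap] must vanish. For [d = 0] the two inequalities would
    not involve [s]. *)
Lemma agm_eq d r s t : 0 < r -> 0 < s -> (0 < d)%N -> r ^+ d.+1 <= s ^+ d * t ->
  d%:R * s + t <= d.+1%:R * r -> s = r.
Proof.
case: d => // d r0 s0 _ rst dst.
have y0 : 0 < r / s by rewrite divr_gt0.
have := bernoulli_gap d (ltW y0).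
have : (r / s) ^+ d.+2 <= t / s.
  rewrite expr_div_n ler_pdivrMr ?exprn_gt0 // (le_trans rst) //.
  by rewrite [s ^+ d.+2]exprS mulrA divfK ?gt_eqF // mulrC.
have : d.+1%:R + t / s <= d.+2%:R * (r / s).
  by rewrite mulrA ler_pdivlMr // mulrDl divfK ?gt_eqF.
move=> h1 h2 h3; have : (r / s - 1) ^+ 2 <= 0 by lra.
rewrite le_eqVlt ltNge sqr_ge0 orbF sqrf_eq0 subr_eq0 => /eqP E.
by rewrite -[r](divfK (lt0r_neq0 s0)) E mul1r.
Qed.

(** Combine [t (s + 1) <= s (t + 1)], used [i] times, with [t <= s], used [n - i] times. Smaller
    links thus have at least as many guaranteed faces per cycle. *)
Lemma expr_ratio_le n i s t : 0 < s -> 0 <= t <= s -> (i <= n)%N ->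
  t ^+ n * (s + 1) ^+ i <= s ^+ n * (t + 1) ^+ i.
Proof.
move=> s0 /andP[t0 ts] /subnK <-; rewrite !exprD -!mulrA -!exprMn.
apply: ler_pM; rewrite ?exprn_ge0 ?mulr_ge0 ?lerXn2r ?nnegrE ?mulr_ge0 //; nra.
Qed.

(** The right side is the coefficient of [x^(i + 1)] in [(1 + s x)^d (1 + t x)]. After division by
    [s^(i + 1)] the binomials become the weights [i + 1] and [d - i] of [weighted_agm] at
    [r / s]. *)
Lemma binomial_agm d i r s t : 0 <= r -> 0 < s -> r ^+ d.+1 <= s ^+ d * t ->
  'C(d.+1, i.+1)%:R * r ^+ i.+1 <=
  'C(d, i.+1)%:R * s ^+ i.+1 + 'C(d, i)%:R * (s ^+ i * t).
Proof.
move=> r0 s0 rst.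
have t0 : 0 <= t.
  by rewrite -(pmulr_rge0 _ (exprn_gt0 d s0)) (le_trans _ rst) ?exprn_ge0.
have [di|id] := ltnP d i; first by rewrite !bin_small // ?mul0r ?addr0 // ltnW.
have y0 : 0 <= r / s by rewrite divr_ge0 // ltW.
have yd : (r / s) ^+ d.+1 <= t / s.
  rewrite expr_div_n ler_pdivrMr ?exprn_gt0 // (le_trans rst) //.
  by rewrite [s ^+ d.+1]exprS mulrA divfK ?gt_eqF // mulrC.
have := weighted_agm i.+1 (d - i) y0; rewrite addSn subnKC // => W.
rewrite -(ler_pM2l (_ : 0 < d.+1%:R)) ?ltr0n // mulrDr !mulrA -!natrM.
have -> : (d.+1 * 'C(d, i) = i.+1 * 'C(d.+1, i.+1))%N by rewrite -mul_bin_diag.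
have -> : (d.+1 * 'C(d, i.+1) = (d - i) * 'C(d.+1, i.+1))%N
  by rewrite -subSS -mul_bin_down.
rewrite [(d.+1 * _)%N]mulnC [(i.+1 * _)%N]mulnC [((d - i) * _)%N]mulnC !natrM -!mulrA -mulrDr.
rewrite ler_wpM2l ?ler0n //.
have -> : r ^+ i.+1 = (r / s) ^+ i.+1 * s ^+ i.+1.
  by rewrite expr_div_n divfK // expf_neq0 // gt_eqF.
have -> : s ^+ i * t = t / s * s ^+ i.+1.
  by rewrite exprS mulrA divfK ?gt_eqF // mulrC.
have : (i.+1%:R : R) * (r / s) ^+ d.+1 <= i.+1%:R * (t / s)
  by rewrite ler_wpM2l ?ler0n.
move: W (ltW (exprn_gt0 i.+1 s0));
  move: (r / s) (t / s) (s ^+ i.+1) => y z p W p0 yz.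
by rewrite !mulrA -mulrDl ler_wpM2r // (le_trans W) // lerD2l.
Qed.
End Inequalities.

(** For [n = 0] the left side is 1, whence the second hypothesis. *)
Lemma powR_rootK (R : realType) n (x : R) :
  0 <= x -> (n = 0%N -> x = 1) -> (x `^ n%:R^-1) ^+ n = x.
Proof.
move=> x0; case: n => [->//|n _].
by rewrite -powR_mulrn ?powR_ge0 // -powRrM mulVf ?powRr1 // pnatr_eq0.
Qed.

(* Add up the AM-GM inequalities for d copies of s/(s+1) and t/(t+1), and for
   d copies of 1/(s+1) and 1/(t+1). *)
Lemma expr_add1_le (R : realType) d (r s t : R) : 0 <= r -> 0 < s -> 0 <= t ->
  r ^+ d.+1 <= s ^+ d * t -> (r + 1) ^+ d.+1 <= (s + 1) ^+ d * (t + 1).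
Proof.
move=> r0 s0 t0 rst; have s1 : 0 < s + 1 by rewrite addr_gt0.
have t1 : 0 < t + 1 by rewrite ltr_wpDl.
have p0 : 0 < (s + 1) ^+ d * (t + 1) by rewrite mulr_gt0 ?exprn_gt0.
(* [G] is the geometric mean of [d] copies of [s + 1] and one [t + 1]; the goal becomes
   [r + 1 <= G]. *)
set G := ((s + 1) ^+ d * (t + 1)) `^ d.+1%:R^-1.
have GE : G ^+ d.+1 = (s + 1) ^+ d * (t + 1) by apply: powR_rootK => //;
  apply: ltW.
have G1 : 0 < G by apply: powR_gt0.
have G0 := ltW G1.
rewrite -GE lerXn2r ?nnegrE ?addr_ge0 //.
have := @agm _ d (r / G) (s / (s + 1)) (t / (t + 1)).
have := @agm _ d (1 / G) (1 / (s + 1)) (1 / (t + 1)).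
rewrite !divr_ge0 // !divr_gt0 // !expr_div_n GE !expr1n =>
  /(_ isT isT) h1 /(_ isT isT) h2.
have : d.+1%:R * ((r + 1) / G) <= d.+1%:R.
  have -> : d.+1%:R * ((r + 1) / G) = d.+1%:R * (1 / G) + d.+1%:R * (r / G)
    by rewrite -mulrDr -mulrDl addrC.
  have E : d%:R * (1 / (s + 1)) + 1 / (t + 1) + (d%:R * (s / (s + 1)) + t / (t + 1)) =
      d.+1%:R by rewrite -natr1; field; rewrite !gt_eqF.
  rewrite -[leRHS]E; apply: lerD; [apply: h1 | apply: h2].
    by rewrite !mul1r invfM.
  by rewrite mulrACA -invfM ler_wpM2r // invr_ge0 ltW.
by rewrite -ler_pdivlMl ?ltr0n // mulVf ?pnatr_eq0 // ler_pdivrMr // mul1r.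
Qed.

(** * Lower bound and extremal complexes *)

Lemma deletion_ind (V : finType) (C : {set V}) (P : {set V} -> Prop) :
  P C -> (forall (A : {set V}) w, C \subset A -> w \in A -> w \notin C -> P (A :\ w) -> P A) ->
  forall A : {set V}, C \subset A -> P A.
Proof.
move=> PC PD A; move: {2}#|A :\: C| (erefl #|A :\: C|) => n.
elim: n A => [|n IHn] A An CA.
  move/eqP: An; rewrite cards_eq0 setD_eq0 => AC.
  by rewrite (_ : A = C) //; apply/eqP; rewrite eqEsubset AC.
have /card_gt0P[w] : (0 < #|A :\: C|)%N by rewrite An.
rewrite inE => /andP[wC wA]; have CAw : C \subset A :\ w by rewrite subsetD1 CA.
apply: (PD _ w) => //; apply: IHn => //.
have := cardsD1 w (A :\: C); rewrite inE wC wA An add1n => -[->].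
by rewrite !setDDl setUC.
Qed.

Section LowerBound.
Variables (R : realType) (F : fieldType) (V : finType) (e : rel V).
Hypothesis e_sym : symmetric e.
Implicit Types (v w : V) (A B C : {set V}) (d i k m : nat).

Local Notation nb := (nb e).
Local Notation nface := (nface e).
Local Notation dcyc := (dcyc F e).

Lemma nface_link_eq0 A v k : v \in A -> nface A k.+1 = 0%N -> nface (A :&: nb v) k = 0%N.
Proof. by move=> vA; rewrite (nfaceS e_sym k vA) => /eqP;
  rewrite addn_eq0 => /andP[_ /eqP]. Qed.

(** Each deletion costs at most [b] by [dcycS], since a link in a subset of [A] lies in the link in
    [A]. *)
Lemma dcyc_deletion A C k b : C \subset A ->
    {in A, forall w, dcyc (A :&: nb w) k <= b}%N ->
  (dcyc A k.+1 <= dcyc C k.+1 + #|A :\: C| * b)%N.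
Proof.
move: A; apply: deletion_ind => [_|A w CA wA wC IH Ab].
  by rewrite setDv cards0 addn0.
apply: leq_trans (dcycS _ e_sym k wA) _.
have -> : #|A :\: C| = #|(A :\ w) :\: C|.+1.
  by rewrite (cardsD1 w) inE wC wA add1n !setDDl setUC.
rewrite mulSn addnCA addnC; apply: leq_add; first exact: Ab.
apply: IH => u /setD1P[_ uA]; apply: leq_trans (Ab _ uA).
exact/dcyc_mono/setSI/subsetDl.
Qed.

(* Deleting w removes the i-faces of its link from the face count and lowers
   dcyc by at most that of the link, so a lower bound x / b for the ratio of the
   two, valid on all links, propagates to A. *)
Lemma nface_deletion A C k i (b x : R) : 0 <= b -> C \subset A ->
    (forall w B, w \in A -> B \subset A :&: nb w ->
      (dcyc B k)%:R * x <= b * (nface B i)%:R) -> 0 <= x ->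
  b * (nface C i.+1)%:R + (dcyc A k.+1)%:R * x <=
  b * (nface A i.+1)%:R + (dcyc C k.+1)%:R * x.
Proof.
move=> b0 CA Ab x0; move: A CA Ab;
  apply: deletion_ind => [_|A w CA wA wC IH Ab].
  by [].
have /IH : forall u B, u \in A :\ w -> B \subset (A :\ w) :&: nb u ->
    (dcyc B k)%:R * x <= b * (nface B i)%:R.
  move=> u B /setD1P[_ uA] BA; apply: Ab uA _; apply: subset_trans BA _.
  exact/setSI/subsetDl.
have := Ab w _ wA (subxx _).
have : (dcyc A k.+1)%:R * x <= ((dcyc (A :\ w) k.+1)%:R + (dcyc (A :&: nb w) k)%:R) * x.
  by rewrite ler_wpM2r // -natrD ler_nat dcycS.
rewrite (nfaceS e_sym i wA) natrD mulrDr mulrDl; lra.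
Qed.

(** If no link carried a cycle, deleting all vertices would cost nothing, but [set0] has no cycles
    in degree [k.+1]. *)
Lemma max_link A k : (0 < dcyc A k.+1)%N ->
  exists v, [/\ v \in A, (0 < dcyc (A :&: nb v) k)%N
    & {in A, forall w, dcyc (A :&: nb w) k <= dcyc (A :&: nb v) k}%N].
Proof.
move=> Apos; have dcyc0 : dcyc set0 k.+1 = 0%N.
  by apply/eqP; rewrite -leqn0 -(nface_set0 e k) dcyc_le_nface.
have [A0|[v0 v0A]] := set_0Vmem A; first by rewrite A0 dcyc0 in Apos.
case: (arg_maxnP (fun v => dcyc (A :&: nb v) k) v0A) => v vA vmax.
exists v; split=> //; rewrite lt0n; apply/eqP => b0.
suff : (dcyc A k.+1 <= 0)%N by rewrite leqNgt Apos.
have := @dcyc_deletion A set0 k 0 (sub0set _); rewrite dcyc0 muln0; apply.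
by move=> w wA; rewrite -b0; apply: vmax.
Qed.

Lemma dcyc0_eq1 A : (0 < dcyc A 0)%N -> dcyc A 0 = 1%N.
Proof. by move=> A0; apply/eqP;
  rewrite eqn_leq A0 -(nface0 e A) dcyc_le_nface. Qed.

(** For [k = 0] the power is 1, and so is [dcyc A 0] by [dcyc0_eq1]. *)
Lemma dcyc_root A k (s := (dcyc A k)%:R `^ k%:R^-1 : R) : (0 < dcyc A k)%N ->
  0 < s /\ s ^+ k = (dcyc A k)%:R.
Proof.
move=> A0; split; first by apply: powR_gt0; rewrite ltr0n.
by apply: powR_rootK => // k0; move: A0; rewrite k0 => /dcyc0_eq1 ->.
Qed.

Lemma nface_setU1_link A v i : nface (v |: (A :&: nb v)) i.+1 =
  (nface (A :&: nb v) i.+1 + nface (A :&: nb v) i)%N.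
Proof.
rewrite (nfaceS e_sym i (setU11 _ _)) setU1K ?inE ?eqxx ?andbF //.
congr (_ + nface _ _)%N.
rewrite setIUl -setIA setIid (_ : [set v] :&: _ = set0) ?set0U //.
by apply/setP => u; rewrite !inE; case: eqP.
Qed.

(** Any [r] up to the root is allowed, so that in the extremal case [m] can be used for a link whose
    cycles are only bounded below. *)
Lemma nface_ge d A (r : R) : 0 <= r -> nface A d.+1 = 0%N -> (0 < dcyc A d)%N ->
  r ^+ d <= (dcyc A d)%:R ->
  forall i, 'C(d, i)%:R * (r + 1) ^+ i <= (nface A i)%:R.
Proof.
elim: d A r => [|d IHd] A r r0 Ad Apos rA [|i].
- by rewrite nface0 bin0 mulr1.
- by rewrite bin0n mul0r.
- by rewrite nface0 bin0 mulr1.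
have [v [vA bpos vmax]] := max_link Apos.
set B := A :&: nb v in bpos vmax; set b := dcyc B d in bpos vmax.
have [s0 sE] := dcyc_root bpos; rewrite -/b in s0 sE.
set s := (_ `^ _) in s0 sE.
have Bd : nface B d.+1 = 0%N by apply: nface_link_eq0.
have IHB := IHd B s (ltW s0) Bd bpos; rewrite sE lexx in IHB;
  have {}IHB := IHB isT.
pose C := v |: B; have CA : C \subset A by rewrite subUset sub1set vA subsetIl.
have dC : dcyc C d.+1 = 0%N by apply: dcyc_cone.
(* By induction [x] bounds [nface B i] from below; [x / b] is the ratio of faces to cycles carried
   through the deletions. *)
pose x : R := 'C(d, i)%:R * (s + 1) ^+ i.
have x0 : 0 <= x by rewrite mulr_ge0 ?ler0n // exprn_ge0 // addr_ge0 // ltW.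
have := @nface_deletion A C d i b%:R x (ler0n _ _) CA.
rewrite nface_setU1_link dC mul0r addr0 natrD => H.
have {}H := H _ x0.
have b0 : (0 : R) < b%:R by rewrite ltr0n.
pose a : R := (dcyc A d.+1)%:R.
have tE : s ^+ d * (a / b%:R) = a by rewrite sE mulrC divfK // gt_eqF.
have t0 : 0 <= a / b%:R by rewrite divr_ge0 ?ler0n.
(* With [t = a / b], the faces found are at least the coefficient of [X^(i + 1)] in
   [(1 + (s + 1) X)^d (1 + (t + 1) X)]. *)
apply: le_trans (@binomial_agm _ d i (r + 1) (s + 1) (a / b%:R + 1) _ _ _) _.
- by rewrite addr_ge0.
- by rewrite addr_gt0.
- by apply: expr_add1_le => //; rewrite tE.
rewrite -(ler_pM2l b0); apply: le_trans (H _).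
  have -> : (dcyc A d.+1)%:R * x = b%:R * (x * (a / b%:R)).
    by rewrite -/a; field; rewrite gt_eqF.
  rewrite -mulrDr ler_pM2l // mulrA -/x.
  have := IHB i.+1; have := IHB i; rewrite -/x; lra.
(* The ratio hypothesis: [Y] satisfies the inductive bound with some [t <= s], and by
   [expr_ratio_le] its ratio is at least [x / b]. *)
move=> w Y wA YA; have [->|] := posnP (dcyc Y d);
  first by rewrite mul0r mulr_ge0 ?ler0n.
move=> Ypos; have [di|id] := ltnP d i.
  by rewrite /x bin_small // mul0r mulr0 mulr_ge0 ?ler0n.
have [t0' tE'] := dcyc_root Ypos; set t := (_ `^ _) in t0' tE'.
have Yb : (dcyc Y d <= b)%N by apply: leq_trans (vmax w wA); apply: dcyc_mono.
have ts : t <= s by rewrite ge0_ler_powR ?invr_ge0 ?nnegrE ?ler0n ?ler_nat.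
clearbody s t.
have Yd : nface Y d.+1 = 0%N.
  by apply/eqP; rewrite -leqn0 -(nface_link_eq0 wA Ad) nface_mono.
have := IHd Y t (ltW t0') Yd Ypos; rewrite tE' lexx => /(_ isT i) IHY.
have t0s : 0 <= t <= s by rewrite (ltW t0') ts.
have := expr_ratio_le s0 t0s id; rewrite tE' sE => st.
apply: le_trans (_ : b%:R * ('C(d, i)%:R * (t + 1) ^+ i) <= _); last first.
  by rewrite ler_pM2l.
by rewrite /x !(mulrCA _ 'C(d, i)%:R) ler_wpM2l ?ler0n.
Qed.

(** A certificate that [e] on [A] is the Turan graph with [d] parts of size [m.+1], the parts being
    the colour classes. *)
Definition turan_coloring A d m (c : V -> nat) : Prop :=
  [/\ {in A, forall u, c u < d}%N, {in A &, forall u v, u != v -> e u v = (c u != c v)}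
    & forall j, (j < d)%N -> #|[set u in A | c u == j]| = m.+1].

(** Counting vertices gives [d s + x <= (d + 1) m], and deletion gives [m^(d + 1) <= s^d x]; this is
    the equality case of AM-GM. *)
Lemma extremal_link A v d m : (0 < m)%N -> nface A d.+2 = 0%N ->
    (m ^ d.+1 <= dcyc A d.+1)%N -> (#|A| <= d.+1 * m.+1)%N -> v \in A ->
    {in A, forall w, dcyc (A :&: nb w) d <= dcyc (A :&: nb v) d}%N ->
    (0 < dcyc (A :&: nb v) d)%N ->
  [/\ dcyc (A :&: nb v) d = (m ^ d)%N, #|A :&: nb v| = (d * m.+1)%N
    & #|A :\: (v |: (A :&: nb v))| = m].
Proof.
move=> m0 Ad mA cA vA vmax bpos.
have Bd := nface_link_eq0 vA Ad.
set B := A :&: nb v in vmax bpos Bd *; set b := dcyc B d in vmax bpos *.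
set C := v |: B; have CA : C \subset A by rewrite subUset sub1set vA subsetIl.
have vB : v \notin B by rewrite !inE eqxx andbF.
have dC : dcyc C d.+1 = 0%N by apply: dcyc_cone.
set x := #|A :\: C|.
have cardA : #|A| = (#|B| + x.+1)%N.
  by rewrite -(cardsID C A) (setIidPr CA) cardsU1 vB -/x; lia.
have [s0 sE] := dcyc_root bpos; set s := (_ `^ _) in s0 sE.
have mx : (m%:R : R) ^+ d.+1 <= s ^+ d * x%:R.
  rewrite sE -natrX -natrM ler_nat (leq_trans mA) // mulnC.
  by have := dcyc_deletion CA vmax; rewrite dC.
have sB : d%:R * (s + 1) <= #|B|%:R.
  have sb : s ^+ d <= b%:R by rewrite sE.
  by have := nface_ge (ltW s0) Bd bpos sb 1; rewrite bin1 expr1 nface1.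
have cA' : (#|B|%:R + x%:R + 1 <= d.+1%:R * (m%:R + 1) :> R).
  by rewrite -natrD !natr1 -natrM ler_nat -addnS -cardA.
have mR : (0 : R) < m%:R by rewrite ltr0n.
have ge := agm (ltW mR) s0 mx.
have le : d%:R * s + x%:R <= d.+1%:R * m%:R by rewrite -natr1 in cA' *; lra.
(* For [d = 0] the equality case says nothing about [s], which then enters only through [d * s] and
   [s ^+ d]. *)
have sm : (0 < d)%N -> s = m%:R by move=> d0; apply: agm_eq le.
have dsm : d%:R * s = d%:R * m%:R by have [->|/sm ->//] := posnP d;
  rewrite !mul0r.
have xm : x = m.
  by apply/eqP; rewrite -(eqr_nat R); apply/eqP; rewrite -natr1 in le ge; lra.
split=> //.
- apply/eqP; rewrite -(eqr_nat R) -/b -sE natrX.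
  by have [->|/sm ->//] := posnP d.
- apply/eqP; rewrite -(eqr_nat R) natrM -[m.+1%:R]natr1; apply/eqP.
  by move: cA'; rewrite xm -natr1; lra.
Qed.

(** The non-neighbours of [v], with [v] itself, form one part, and the link [B] is coloured by
    induction. *)
Lemma extremal_coloring d A m : (0 < m)%N -> nface A d.+1 = 0%N ->
    (m ^ d <= dcyc A d)%N -> (#|A| <= d * m.+1)%N ->
  exists c, turan_coloring A d m c.
Proof.
move=> m0; elim: d A => [|d IHd] A Ad mA cA.
  move: cA; rewrite leqn0 cards_eq0 => /eqP ->; exists (fun=> 0%N).
  by split=> // u; rewrite inE.
have Apos : (0 < dcyc A d.+1)%N by apply: leq_trans mA; rewrite expn_gt0 m0.
have [v [vA bpos vmax]] := max_link Apos.
have [bE cB cW] := extremal_link m0 Ad mA cA vA vmax bpos.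
have Bd := nface_link_eq0 vA Ad.
set B := A :&: nb v in vmax bpos bE cB cW Bd; pose W := A :\: B.
have BA : B \subset A by apply: subsetIl.
have vB : v \notin B by rewrite !inE eqxx andbF.
have vW : v \in W by rewrite inE vB.
have WvE : A :\: (v |: B) = W :\ v by rewrite setUC -setDDl.
rewrite WvE in cW.
have cWm : #|W| = m.+1 by rewrite (cardsD1 v) vW cW.
have CA : v |: B \subset A by rewrite subUset sub1set vA.
have dC : dcyc (v |: B) d.+1 = 0%N by apply: dcyc_cone.
have vmaxm : {in A, forall w, dcyc (A :&: nb w) d <= m ^ d}%N by rewrite -bE.
(* Delete [Z], then [w], then the rest of [W :\ v]: these [m] deletions cost at most [m ^ d] each,
   and [m ^ d.+1] is reached only if that of [w] costs the full amount. *)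
have link_ge w (Z : {set V}) : Z \subset W :\ v -> w \in W :\ v -> w \notin Z ->
    (m ^ d <= dcyc ((A :\: Z) :&: nb w) d)%N.
  move=> ZW wW wZ; have /subsetP WA : W :\ v \subset A by rewrite -WvE subsetDl.
  have wAZ : w \in A :\: Z by rewrite inE wZ WA.
  have AZE : A :\: (A :\: Z) = Z.
    by rewrite setDDr setDv set0U; apply/setIidPr/(subset_trans ZW)/subsetP.
  have CZ : v |: B \subset (A :\: Z) :\ w.
    apply/subsetP => u uC; have uA := subsetP CA _ uC.
    have uW : u \notin W :\ v by rewrite -WvE inE uC.
    rewrite !inE uA andbT (contraNneq _ uW) => [|->//]; rewrite /=.
    by apply: contra uW; apply: (subsetP ZW).
  have rest : (#|((A :\: Z) :\ w) :\: (v |: B)| + #|Z|).+1 = m.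
    rewrite (_ : _ :\: (v |: B) = (W :\ v :\: Z) :\ w); last first.
      apply/setP => u; rewrite !in_setD !in_set1 in_setU1 negb_or.
      by case: (u == v) (u \in B) (u == w) (u \in Z) => [] [] [] [].
    have := cardsD1 w (W :\ v :\: Z); rewrite inE wZ wW add1n cardsDS // cW.
    by move: (subset_leq_card ZW); rewrite cW; clear; lia.
  have := dcyc_deletion (subsetDl A Z) vmaxm; rewrite AZE.
  have := dcycS F e_sym d wAZ.
  have : (dcyc ((A :\: Z) :\ w) d.+1 <=
          dcyc (v |: B) d.+1 + #|((A :\: Z) :\ w) :\: (v |: B)| * m ^ d)%N.
    apply: dcyc_deletion => // u; rewrite !inE => /and3P[_ _ uA].
    apply: leq_trans (vmaxm _ uA); apply/dcyc_mono/setSI.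
    by rewrite setDDl subsetDl.
  move: mA; rewrite dC expnS -{1}rest mulSn mulnDl.
  by clear; lia.
(* Delete u before w: the link of w in A :\ u is already as large as the full
   link, so w and u are not adjacent. *)
have WP w : w \in W -> A :&: nb w = B.
  have [->//|wv wW] := eqVneq w v.
  have {}wW : w \in W :\ v by rewrite in_setD1 wv.
  have [wA wB] : w \in A /\ w \notin B.
    by move: wW; rewrite !inE => /and3P[].
  have wE : dcyc (A :&: nb w) d = (m ^ d)%N.
    have := link_ge w set0 (sub0set _) wW (negbT (in_set0 w));
      rewrite setD0 => wge.
    by apply/eqP; rewrite eqn_leq vmaxm.
  have wpos : (0 < dcyc (A :&: nb w) d)%N by rewrite wE expn_gt0 m0.
  have wmax : {in A, forall u, dcyc (A :&: nb u) d <= dcyc (A :&: nb w) d}%N.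
    by rewrite wE.
  have [_ cw _] := extremal_link m0 Ad mA cA wA wmax wpos.
  apply/eqP; rewrite eqEcard cw cB leqnn andbT; apply/subsetP => u.
  rewrite inE => /andP[uA uw]; apply: contraT => uB.
  have uv : u != v.
    apply: contraNneq wB => uv; move: uw; rewrite uv !inE wA e_sym eq_sym.
    by rewrite /B => ->.
  have uW : u \in W :\ v by rewrite in_setD1 uv in_setD uB uA.
  have nuw : w \notin [set u] by move: uw; rewrite !inE eq_sym => /andP[].
  have uZ : [set u] \subset W :\ v by rewrite sub1set.
  have ge := link_ge w _ uZ wW nuw.
  have L0 : nface ((A :\ u) :&: nb w) d.+1 = 0%N.
    apply/eqP; rewrite -leqn0 -(nface_link_eq0 wA Ad).
    exact/nface_mono/setSI/subsetDl.
  have Lpos : (0 < dcyc ((A :\ u) :&: nb w) d)%N.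
    by apply: leq_trans ge; rewrite expn_gt0 m0.
  have geR : (m%:R : R) ^+ d <= (dcyc ((A :\ u) :&: nb w) d)%:R.
    by rewrite -natrX ler_nat.
  (* By its linear coefficient, the link of [w] without [u] still has at least [d * m.+1] vertices,
     as many as the link with [u]. *)
  have := nface_ge (ler0n R m) L0 Lpos geR 1.
  rewrite bin1 expr1 (nface1 e_sym) natr1 -natrM ler_nat -cw leqNgt => /negP[].
  apply: proper_card; apply/properP; split; first exact/setSI/subsetDl.
  by exists u; rewrite !inE ?uA ?eqxx //; move: uw; rewrite inE.
have bm : (m ^ d <= dcyc B d)%N by rewrite bE.
have [c [cd cadj ccard]] := IHd B Bd bm (eq_leq cB).
have WE u : u \in A -> u \notin B -> u \in W by move=> uA uB; rewrite inE uB.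
have WnB u w : u \in A -> u \notin B -> w \in A -> u != w -> e u w = (w \in B).
  by move=> uA uB wA uw; rewrite -(WP u) ?WE // !inE wA eq_sym uw.
move: WnB cWm; rewrite /W; clearbody B => WnB cWm.
exists (fun u => if u \in B then c u else d); split.
- by move=> u uA; case: ifP => // /cd /ltnW.
- move=> u w uA wA uw; have [uB|uB] := boolP (u \in B);
  have [wB|wB] := boolP (w \in B).
  + exact: cadj.
  + by rewrite e_sym (WnB w u) // 1?eq_sym // uB; have := cd u uB; case: ltngtP.
  + by rewrite (WnB u w) // wB; have := cd w wB; case: ltngtP.
  + by rewrite (WnB u w) // (negbTE wB) eqxx.
- move=> j; rewrite ltnS leq_eqVlt => /orP[/eqP ->|jd].
    rewrite -cWm; apply: eq_card => u; rewrite !inE andbC; congr (_ && _).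
    by case: ifP => uB; [have := cd u uB; case: ltngtP | rewrite eqxx].
  rewrite -(ccard j jd); apply: eq_card => u; rewrite !inE.
  by case: ifP => uB; [rewrite (subsetP BA) | rewrite gtn_eqF // andbF].
Qed.
End LowerBound.

(** * Turan complexes *)

Section Turan.
Variables (F : fieldType) (V : finType) (e : rel V).
Hypothesis e_sym : symmetric e.
Implicit Types (u v w : V) (A B : {set V}) (d i k m : nat).

Local Notation nb := (nb e).
Local Notation nface := (nface e).
Local Notation dcyc := (dcyc F e).

(** Peels off the last colour class. Its vertices are pairwise non-adjacent and joined to all of
    [B], so their link is [B] at every stage [Y] of a deletion. *)
Lemma turan_coloring_restrict A d m c : turan_coloring e A d.+1 m c ->
  let B := [set u in A | (c u < d)%N] in
  [/\ turan_coloring e B d m c, #|A :\: B| = m.+1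
    & {in A :\: B, forall w (Y : {set V}), B \subset Y -> Y \subset A -> Y :&: nb w = B}].
Proof.
move=> [cd cadj ccard] B; split.
- split=> [u|u v|j jd]; rewrite ?inE; first by case/andP.
    by case/andP=> uA _ /andP[vA _]; apply: cadj.
  rewrite -(ccard j (ltnW jd)); apply: eq_card => u; rewrite !inE -andbA;
    congr (_ && _).
  by case: eqP => [->|]; rewrite ?jd ?andbF.
- rewrite -(ccard d (ltnSn d)); apply: eq_card => u; rewrite !inE andbC.
  have [uA|//] := boolP (u \in A); have := cd u uA; rewrite /= ltnS.
  by case: ltngtP.
- move=> w; rewrite !inE => /andP[+ wA] Y BY YA; rewrite wA /= => cw.
  have {}cw : c w = d by move: cw (cd w wA); rewrite ltnS; case: ltngtP.
  apply/setP => u; rewrite !inE.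
  have [uA|uA] := boolP (u \in A); last first.
    by case: (boolP (u \in Y)) => // /(subsetP YA); rewrite (negbTE uA).
  have [->|uw] := eqVneq u w; first by rewrite cw ltnn /= andbF.
  rewrite (cadj w u) // 1?eq_sym // cw /=.
  have := cd u uA; rewrite ltnS; case: ltngtP => //= ud _;
    last by rewrite andbF.
  by rewrite andbT (subsetP BY) // inE uA.
Qed.

(** Each of the [m.+1] vertices of the last part contributes the faces of [B] with one vertex fewer;
    Pascal's rule adds up. *)
Lemma nface_turan A d m c i : turan_coloring e A d m c ->
  nface A i = ('C(d, i) * m.+1 ^ i)%N.
Proof.
elim: d A i => [|d IHd] A [|i] tA; rewrite ?nface0 ?bin0 ?muln1 //.
  case: tA => cd _ _; suff -> : A = set0 by rewrite nface_set0.
  by apply/setP => u; rewrite inE; apply/negP => /cd.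
have [tB cW join] := turan_coloring_restrict tA.
set B := [set u in A | _] in tB cW join;
  have BA : B \subset A by apply/subsetP => u; rewrite inE => /andP[].
have H (Y : {set V}) : B \subset Y -> Y \subset A ->
    nface Y i.+1 = (nface B i.+1 + #|Y :\: B| * nface B i)%N.
  move: Y; apply: deletion_ind => [_|Y w BY wY wB IH YA].
    by rewrite setDv cards0 addn0.
  have wAB : w \in A :\: B by rewrite inE wB (subsetP YA).
  rewrite (nfaceS e_sym i wY) IH ?(subset_trans _ YA) ?subsetDl //.
  rewrite (join w wAB Y BY YA) (cardsD1 w (Y :\: B)) in_setD wB wY.
  by rewrite !setDDl setUC mulSn addnAC addnA.
by rewrite (H A) // cW !(IHd B) // binS mulnDl mulnCA -expnS.
Qed.

(** The first vertex of the last part only cones off [B]; each later one adds the cycles of [B] by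
    [dcyc_join], as an earlier vertex has the same link. *)
Lemma dcyc_turan A d m c : turan_coloring e A d m c -> (m ^ d <= dcyc A d)%N.
Proof.
elim: d A => [|d IHd] A tA.
  have -> : A = set0.
    by case: tA => cd _ _; apply/setP => u; rewrite inE; apply/negP => /cd.
  rewrite expn0 lt0n dimv_eq0; apply/negP => /eqP c0.
  (* With no vertices, the indicator of the empty face is a nonzero cycle. *)
  have : [ffun S : {set V} =>
    (S == set0)%:R : F^o] \in cycles F (cliques e set0) 0.
    apply/cyclesP; split=> [S|].
      rewrite ffunE; case: eqP => // ->; rewrite inE cards0 eqxx andbT.
      move/negP; case; apply/cliquesP; split; first exact: sub0set.
      by move=> u v; rewrite inE.
    apply/ffunP => T; rewrite !ffunE big1 // => v _; rewrite ffunE.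
    case: eqP => [/setP/(_ v)|]; rewrite ?mulr0 //.
    by rewrite setU11 inE.
  rewrite c0 memv0 => /eqP/ffunP/(_ set0); rewrite !ffunE eqxx => /eqP.
  by rewrite oner_eq0.
have [tB cW join] := turan_coloring_restrict tA.
set B := [set u in A | _] in tB cW join;
  have BA : B \subset A by apply/subsetP => u; rewrite inE => /andP[].
have H (Y : {set V}) : B \subset Y -> Y \subset A ->
    (#|Y :\: B|.-1 * dcyc B d <= dcyc Y d.+1)%N.
  move: Y; apply: deletion_ind => [_|Y w BY wY wB IH YA].
    by rewrite setDv cards0.
  rewrite (cardsD1 w) inE wB wY add1n /=.
  have [->//|[w0 w0Y]] := set_0Vmem ((Y :\: B) :\ w); first by rewrite cards0.
  move: (w0Y); rewrite !in_setD1 in_setD => /and3P[w0w w0B w0A].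
  have wAB : w \in A :\: B by rewrite inE wB (subsetP YA).
  have w0AB : w0 \in A :\: B by rewrite inE w0B (subsetP YA).
  have sub : Y :&: nb w \subset nb w0
    by rewrite join // -(join w0 w0AB Y) // subsetIr.
  have ww0 : w != w0 by rewrite eq_sym.
  have := dcyc_join F e_sym d wY w0A ww0 sub; rewrite join //; apply: leq_trans.
  have := IH (subset_trans (subsetDl _ _) YA).
  have -> : (Y :\ w) :\: B = (Y :\: B) :\ w by rewrite !setDDl setUC.
  have : (0 < #|(Y :\: B) :\ w|)%N by apply/card_gt0P; exists w0.
  by case: #|_| => // n _ /= h; rewrite mulSn addnC leq_add2r.
apply: leq_trans (H A BA (subxx _)); rewrite cW expnS /=.
by rewrite leq_mul2l IHd ?orbT.
Qed.

(** [idx] numbers the vertices within each colour class; [idx v * d + c v] has residue [c v] modulo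
    [d], matching the parts of [turan_graph]. *)
Lemma turan_coloring_iso A d m c : (0 < d)%N -> turan_coloring e A d m c ->
  complex_iso (cliques e A) (clique_complex (turan_graph d (d * m.+1))).
Proof.
move=> d0 [cd cadj ccard].
pose cl v := [set u in A | c u == c v].
pose idx v := index v (enum (cl v)).
have idx_lt v : v \in A -> (idx v < m.+1)%N.
  by move=> vA; rewrite -(ccard _ (cd v vA)) cardE index_mem mem_enum inE vA eqxx.
have n0 : (0 < d * m.+1)%N by rewrite muln_gt0 d0.
(* The default value can occur only outside [A]. *)
pose f v : 'I_(d * m.+1) := insubd (Ordinal n0) (idx v * d + c v)%N.
have fE v : v \in A -> f v = (idx v * d + c v)%N :> nat.
  move=> vA; rewrite val_insubd (_ : (_ < _)%N = true) //.
  apply: (@leq_trans ((idx v).+1 * d));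
    first by rewrite mulSn addnC ltn_add2r cd.
  by rewrite mulnC leq_pmul2l // idx_lt.
have fmod v : v \in A -> (f v %% d)%N = c v.
  by move=> vA; rewrite fE // modnMDl modn_small // cd.
have f_inj : {in A &, injective f}.
  move=> u v uA vA fuv; have cuv : c u = c v by rewrite -!fmod // fuv.
  have : idx u = idx v.
    have := fE u uA; rewrite fuv fE // cuv => /eqP;
      rewrite eqn_add2r eqn_pmul2r //.
    by move/eqP.
  rewrite /idx /cl cuv; set s := enum _.
  have us : u \in s by rewrite mem_enum inE uA cuv eqxx.
  have vs : v \in s by rewrite mem_enum inE vA eqxx.
  by move=> eidx; rewrite -(nth_index u us) eidx nth_index.
(* A preimage of [j] is the element number [j %/ d] of the class of colour [j %% d]. *)
have f_surj j : exists2 v, v \in A & f v = j.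
  set s := enum [set u in A | c u == (j %% d)%N].
  have jd : (j %/ d < size s)%N.
    by rewrite -cardE ccard ?ltn_mod // ltn_divLR // [(_ * d)%N]mulnC.
  have [v0 _] : exists v0, v0 \in s.
    by case: (s) jd => // v0 s' _; exists v0; rewrite mem_head.
  have := mem_nth v0 jd; set v := nth _ _ _;
    rewrite mem_enum inE => /andP[vA /eqP cv].
  exists v => //; apply: val_inj;
    rewrite /= fE // /idx /cl cv index_uniq ?enum_uniq //.
  by rewrite -divn_eq.
have vertE : vertices (cliques e A) = A.
  apply/setP => v; rewrite inE; apply/cliquesP/idP => [[]|vA].
    by rewrite sub1set.
  by split; [rewrite sub1set | move=> u w /set1P -> /set1P ->; rewrite eqxx].
exists f; first by rewrite vertE.
apply/setP => T; apply/imsetP/idP.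
  move=> [S /cliquesP[SA cl_S] ->]; rewrite inE.
  apply/forall_inP => _ /imsetP[u uS ->];
    apply/forall_inP => _ /imsetP[v vS ->].
  apply/implyP => fuv; have [uA vA] := (subsetP SA _ uS, subsetP SA _ vS).
  have uv : u != v by apply: contraNneq fuv => ->.
  by rewrite /turan_graph !fmod // -cadj // cl_S.
rewrite inE => /forall_inP clT; exists [set v in A | f v \in T].
  apply/cliquesP; split; first by apply/subsetP => v; rewrite inE => /andP[].
  move=> u v; rewrite !inE => /andP[uA uT] /andP[vA vT] uv.
  rewrite cadj // -!fmod //; have /forall_inP/(_ _ vT)/implyP := clT _ uT;
    apply.
  by apply: contraNneq uv => /f_inj ->.
apply/setP => j; apply/idP/imsetP => [jT|[v + ->]];
  last by rewrite inE => /andP[].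
by have [v vA vj] := f_surj j; exists v; rewrite // inE vA vj.
Qed.
End Turan.

(** * Homology of complexes *)

Section BettiCycles.
Variables (F : fieldType) (V : finType) (D : {set {set V}}).
Hypothesis Dsc : simplicial_complex D.
Implicit Types (k : nat) (S T : {set V}).

Local Notation chain := {ffun {set V} -> F^o}.

(** Links the coordinates of [boundary] to chains; with inverse [row_of_chain] it is a bijection
    onto the chains supported on [faces D k]. *)
Definition chain_of_row k (x : 'rV[F]_#|faces D k|) : chain :=
  [ffun S : {set V} => \sum_i x 0 i * (enum_val i == S)%:R].

Definition row_of_chain k (z : chain) : 'rV[F]_#|faces D k| :=
  \row_i z (enum_val i).

Fact chain_of_row_linear k : linear (@chain_of_row k).
Proof.
move=> a x y; apply/ffunP => S; rewrite !ffunE scaler_sumr -big_split /=.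
by apply: eq_bigr => i _; rewrite !mxE mulrDl; congr (_ + _); rewrite -mulrA.
Qed.

Fact row_of_chain_linear k : linear (@row_of_chain k).
Proof. by move=> a x y; apply/rowP => i; rewrite !mxE !ffunE. Qed.

HB.instance Definition _ k :=
  GRing.isLinear.Build F 'rV[F]_#|faces D k| chain _ _ (@chain_of_row_linear k).
HB.instance Definition _ k :=
  GRing.isLinear.Build F chain 'rV[F]_#|faces D k| _ _ (@row_of_chain_linear k).

Lemma chain_of_row_val k (x : 'rV_#|faces D k|) i :
  chain_of_row x (enum_val i) = x 0 i.
Proof.
rewrite ffunE (bigD1 i) //= eqxx mulr1 big1 ?addr0 // => j ji.
by rewrite (inj_eq enum_val_inj) (negbTE ji) mulr0.
Qed.

Lemma chain_of_row_out k (x : 'rV_#|faces D k|) S :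
  S \notin faces D k -> chain_of_row x S = 0.
Proof.
move=> SD; rewrite ffunE big1 // => i _; case: eqP => [E|];
  last by rewrite mulr0.
by rewrite -E enum_valP in SD.
Qed.

Lemma row_of_chainK k (z : chain) : (forall S, S \notin faces D k -> z S = 0) ->
  chain_of_row (row_of_chain k z) = z.
Proof.
move=> zD; apply/ffunP => S; have [SD|SD] := boolP (S \in faces D k);
  last first.
  by rewrite chain_of_row_out // zD.
by rewrite -(enum_rankK_in SD SD) chain_of_row_val mxE.
Qed.

Lemma chain_of_rowK k : cancel (@chain_of_row k) (@row_of_chain k).
Proof. by move=> x; apply/rowP => i; rewrite mxE chain_of_row_val. Qed.

(** Off [faces D k] both sides vanish, since [D] is closed under subsets; on it, exchange the two
    sums. *)
Lemma bd_chain_of_row k (x : 'rV_#|faces D k.+1|) :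
  bd (chain_of_row x) = chain_of_row (x *m boundary F D k).
Proof.
apply/ffunP => T; have [TD|TD] := boolP (T \in faces D k); last first.
  rewrite chain_of_row_out // ffunE big1 // => v vT;
    rewrite chain_of_row_out ?mulr0 //.
  apply: contra TD; rewrite !inE cardsU1 vT add1n eqSS => /andP[vTD ->].
  by rewrite andbT; case: Dsc => _; apply; first exact: vTD; apply: subsetUr.
rewrite -(enum_rankK_in TD TD) chain_of_row_val; set j := enum_rank_in _ _.
rewrite mxE [LHS]ffunE; under eq_bigr do rewrite ffunE mulr_sumr.
rewrite exchange_big /=; apply: eq_bigr => i _; rewrite mxE mulr_sumr.
rewrite big_mkcond [RHS]big_mkcond /=; apply: eq_bigr => v _.
set T' := enum_val j; set S := enum_val i.
case: (boolP (v \in T')) => vT; rewrite /=.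
  case: ifP => // /andP[_ /eqP E]; by rewrite -E setD11 in vT.
case: ifP => [/andP[vS /eqP E]|SE].
  rewrite -E setD1K // eqxx mulr1 mulrC /face_sign.
  by rewrite -{2}(setD1K vS) face_pos_setU1_id.
rewrite (_ : (S == _) = false) ?mulr0 //; apply: contraFF SE => /eqP ->.
by rewrite setU11 setU1K //=.
Qed.

(** Free families transfer both ways: a basis of the kernel gives independent cycles, a basis of the
    cycles gives independent rows in the kernel. *)
Lemma rank_cycles k : \rank (kermx (boundary F D k)) = \dim (cycles F D k.+1).
Proof.
set M := boundary F D k; apply/eqP; rewrite eqn_leq; apply/andP; split.
  pose X := [tuple chain_of_row (row i (row_base (kermx M)))
              | i < \rank (kermx M)].
  have Xfree : free X.
    apply/freeP => a; under eq_bigr => i _ do rewrite nth_mktuple -linearZ.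
    rewrite -linear_sum /= => aX i.
    have : (\row_i a i) *m row_base (kermx M) = 0.
      rewrite mulmx_sum_row -[LHS]chain_of_rowK.
      under eq_bigr do rewrite mxE.
      by rewrite aX linear0.
    by move/eqP; rewrite mulmx_free_eq0 ?row_base_free // => /eqP/rowP/(_ i);
      rewrite !mxE.
  have <- : size X = \rank (kermx M) by rewrite size_tuple.
  rewrite -(eqP Xfree); apply: dimvS; apply/span_subvP => _ /mapP[i _ ->].
  apply/cyclesP; split; first by move=> S; apply: chain_of_row_out.
  rewrite bd_chain_of_row (_ : _ *m M = 0) ?linear0 //; apply/sub_kermxP.
  by rewrite (submx_trans (row_sub _ _)) // eq_row_base.
set n := \dim _; pose X := vbasis (cycles F D k.+1).
have XP i : X`_i \in cycles F D k.+1.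
  have [iX|iX] := ltnP i (size X); last by rewrite nth_default ?mem0v.
  exact/vbasis_mem/mem_nth.
have XK i : chain_of_row (row_of_chain k.+1 X`_i) = X`_i.
  by apply: row_of_chainK; case/cyclesP: (XP i).
pose Z := \matrix_(i < n) row_of_chain k.+1 X`_i.
have Zfree : row_free Z.
  apply: inj_row_free => a aZ; apply/rowP => i; rewrite mxE.
  have /freeP/(_ (fun i => a 0 i))/(_ _ i) :=
    basis_free (vbasisP (cycles F D k.+1)); apply.
  under eq_bigr => j _ do rewrite -XK -linearZ.
  rewrite -linear_sum /= (_ : \sum_j _ = 0) ?linear0 //.
  by rewrite -[RHS]aZ mulmx_sum_row; apply: eq_bigr => j _; rewrite rowK.
have ZM : (Z <= kermx M)%MS.
  apply/row_subP => i; rewrite rowK; apply/sub_kermxP.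
  rewrite -[LHS]chain_of_rowK -bd_chain_of_row XK.
  by case/cyclesP: (XP i) => _ ->; rewrite linear0.
by move: (mxrankS ZM); rewrite (eqP Zfree).
Qed.
End BettiCycles.

(** * Face numbers and the f-polynomial *)

Lemma card_faces_gt_max (V : finType) (D : {set {set V}}) i :
  (Defs.max_card D < i)%N -> #|faces D i| = 0%N.
Proof.
move=> di; apply/eqP; rewrite cards_eq0; apply/eqP/setP => S; rewrite in_set0.
apply/negbTE; apply: contraL di; rewrite inE => /andP[SD /eqP <-].
by rewrite -leqNgt; apply: (@leq_bigmax_cond _ (mem D) (fun S : {set V} =>
  #|S|)).
Qed.

Lemma max_cardE (V : finType) (D : {set {set V}}) d :
  (0 < #|faces D d|)%N -> (forall i, (d < i)%N -> #|faces D i| = 0%N) ->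
  Defs.max_card D = d.
Proof.
move=> dpos dmax; apply/eqP; rewrite eqn_leq; apply/andP; split.
  apply/bigmax_leqP => S SD; rewrite leqNgt; apply/negP => /dmax /eqP.
  by rewrite cards_eq0 => /eqP/setP/(_ S); rewrite !inE SD eqxx.
by rewrite leqNgt; apply/negP => /card_faces_gt_max E; rewrite E in dpos.
Qed.

Lemma max_card_face (V : finType) (D : {set {set V}}) :
  simplicial_complex D -> exists2 S, S \in D & #|S| = Defs.max_card D.
Proof.
move=> [D0 _]; have Dpos : (0 < #|D|)%N by apply/card_gt0P; exists set0.
by have [S SD SE] := eq_bigmax_cond (fun S : {set V} => #|S|) Dpos; exists S;
  rewrite // -SE.
Qed.

Lemma complex_dimE (V : finType) (D : {set {set V}}) d :
  (complex_dim D = d%:Z - 1) <-> (Defs.max_card D = d).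
Proof. by rewrite /complex_dim; split => [/addIr[]|->]. Qed.

Lemma coef_f_poly (R : nzRingType) (V : finType) (D : {set {set V}}) i :
  (f_poly R D)`_i = #|faces D i|%:R.
Proof.
rewrite (_ : f_poly R D = \poly_(i < (Defs.max_card D).+1) #|faces D i|%:R).
  by rewrite coef_poly ltnS; case: leqP => // /card_faces_gt_max ->.
by rewrite poly_def.
Qed.

Lemma coef_affine_exp (R : comNzRingType) (x : R) d i :
  ((1 + x *: 'X) ^+ d)`_i = 'C(d, i)%:R * x ^+ i :> R.
Proof.
rewrite exprDn (_ : \sum_(i < _) _ = \poly_(i < d.+1) ('C(d, i)%:R * x ^+ i)).
  by rewrite coef_poly ltnS; case: leqP => // di; rewrite bin_small // mul0r.
rewrite poly_def; apply: eq_bigr => j _.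
by rewrite expr1n mul1r exprZn mulr_natl scalerMnl.
Qed.

(** With no faces on [d.+1] vertices, the next boundary matrix has no rows, so its rank is 0. *)
Lemma top_betti (F : fieldType) (V : finType) (D : {set {set V}}) d :
  simplicial_complex D -> (0 < d)%N -> Defs.max_card D = d ->
  betti F D d.-1 = \dim (cycles F D d).
Proof.
move=> Dsc d0 Dd; rewrite /betti rank_cycles // prednK //.
suff -> : \rank (boundary F D d) = 0%N by rewrite subn0.
apply/eqP; rewrite -leqn0; apply: leq_trans (rank_leq_row _) _.
by rewrite card_faces_gt_max // Dd.
Qed.

(** * Flag complexes as clique complexes, isomorphisms, and model colourings *)

Definition edge (V : finType) (D : {set {set V}}) : rel V :=
  fun u v => [set u; v] \in D.

Lemma edge_sym (V : finType) (D : {set {set V}}) : symmetric (edge D).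
Proof. by move=> u v; rewrite /edge setUC. Qed.

Lemma flag_cliques (V : finType) (D : {set {set V}}) :
  flag_complex D -> D = cliques (edge D) (vertices D).
Proof.
move=> [[_ Dsub] Dflag]; apply/setP => S; apply/idP/cliquesP => [SD|[SV cl]].
  split; first by apply/subsetP => v vS; rewrite inE (Dsub S) ?sub1set.
  by move=> u v uS vS _; apply: (Dsub S) => //; rewrite subUset !sub1set uS.
apply: Dflag => u v uS vS; have [->|] := eqVneq u v; last exact: cl.
by rewrite setUid; have := subsetP SV v vS; rewrite inE.
Qed.

(** Injectivity is known on vertices only; faces consist of vertices, so taking images is injective
    on [D] and keeps sizes. *)
Lemma card_faces_iso (V W : finType) (D : {set {set V}}) (E : {set {set W}}) i :
  simplicial_complex D -> complex_iso D E -> #|faces D i| = #|faces E i|.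
Proof.
move=> [_ Dsub] [f f_inj <-].
have DV S : S \in D -> {subset S <= vertices D}.
  by move=> SD v vS; rewrite inE (Dsub S) // sub1set.
have card_f S : S \in D -> #|f @: S| = #|S|.
  by move=> SD; apply: card_in_imset => u v /(DV S SD) uV /(DV S SD) vV;
    apply: f_inj.
rewrite -[LHS](card_in_imset (f := fun S : {set V} => f @: S)).
  apply: eq_card => T; rewrite [RHS]inE;
    apply/imsetP/andP => [[S + ->]|[/imsetP[S SD ->]]].
    by rewrite inE => /andP[SD /eqP <-]; rewrite card_f // imset_f.
  by rewrite card_f // => Si; exists S; rewrite // inE SD.
move=> S T; rewrite !inE => /andP[SD _] /andP[TD _] fST.
have half (S' T' : {set V}) : S' \in D -> T' \in D -> f @: S' = f @: T' -> S' \subset T'.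
  move=> SD' TD' fE; apply/subsetP => v vS;
    have : f v \in f @: T' by rewrite -fE imset_f.
  case/imsetP => u uT /f_inj -> //; first exact: DV vS.
  exact: DV uT.
by apply/eqP; rewrite eqEsubset !half.
Qed.

Lemma clique_complex_setT (V : finType) (e : rel V) :
  clique_complex e = cliques e setT.
Proof. by apply/setP => S; rewrite [RHS]inE subsetT andbT. Qed.

Lemma turan_graph_coloring d m : (0 < d)%N ->
  turan_coloring (turan_graph d (d * m.+1)) setT d m (fun i => (i %% d)%N).
Proof.
move=> d0; split=> [i _|i j _ _ _|j jd] //; first exact: ltn_pmod.
rewrite (_ : [set _ in _ | _] = [set i : 'I_(d * m.+1) | i %% d == j]%N).
  by rewrite card_turan_part // mulKn // modnMr ltn0 addn0.
by apply/setP => i; rewrite !inE.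
Qed.

Lemma f_poly_turan (R : realType) (V W : finType) (D : {set {set W}})
    (e : rel V) A d m c :
  symmetric e -> turan_coloring e A d m c ->
  (forall i, #|faces D i| = nface e A i) ->
  f_poly R D = (1 + (m%:R + 1) *: 'X) ^+ d.
Proof.
move=> e_sym tA DA; apply/polyP => i; rewrite coef_f_poly coef_affine_exp DA.
by rewrite (nface_turan e_sym i tA) natrM natrX natr1.
Qed.

(** A simplex is the case of parts with one vertex; it serves the equality case [m = 0]. *)
Lemma simplex_coloring (V : finType) (e : rel V) (A : {set V}) :
  {in A &, forall u v, u != v -> e u v} ->
  turan_coloring e A #|A| 0 (fun v => index v (enum A)).
Proof.
move=> eA; split=> [u uA|u v uA vA uv|j jA].
- by rewrite cardE index_mem mem_enum.
- rewrite eA //; apply/esym; apply: contra uv => /eqP E.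
  by rewrite -(nth_index u (_ : u \in enum A)) ?E ?nth_index ?mem_enum.
rewrite cardE in jA; have [v0 _] : exists v0, v0 \in enum A.
  by case: (enum A) jA => // v0 s _; exists v0; rewrite mem_head.
rewrite -(cards1 (nth v0 (enum A) j)); apply: eq_card => u; rewrite !inE.
apply/andP/eqP => [[uA /eqP <-]|->]; first by rewrite nth_index ?mem_enum.
by rewrite -mem_enum mem_nth // index_uniq ?enum_uniq.
Qed.

Theorem theorem1p5 (R : realType) (F : fieldType) (d a : nat) (hd : (0 < d)%N) :
  let r : R := a%:R `^ d%:R^-1 in
  let bound : {poly R} := (1 + (r + 1) *: 'X) ^+ d in
  (forall (V : finType) (D : {set {set V}}),
      flag_complex D -> complex_dim D = d%:Z - 1 -> betti F D d.-1 = a ->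
      coef_le bound (f_poly R D)) /\
  (forall m : nat, r = m%:R ->
      (exists (V : finType) (D : {set {set V}}),
          [/\ flag_complex D, complex_dim D = d%:Z - 1, betti F D d.-1 = a
            & f_poly R D = bound]) /\
      (forall (V : finType) (D : {set {set V}}),
          flag_complex D -> complex_dim D = d%:Z - 1 -> betti F D d.-1 = a ->
          (f_poly R D = bound <->
           complex_iso D (clique_complex (turan_graph d (d * m.+1)%N))))).
Proof.
move=> r bound.
have dn0 : d <> 0%N by case: (d) hd.
have r0 : 0 <= r by apply: powR_ge0.
have rE : r ^+ d = a%:R by apply: powR_rootK.
split=> [V D Dflag /complex_dimE Dd Da i|m rm].
  rewrite coef_affine_exp coef_f_poly.
  have Dsc : simplicial_complex D by case: Dflag.
  (* For [a = 0] the bound is [(1 + x)^d], already reached by the subsets of one face of size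
     [d]. *)
  have [a0|apos] := posnP a.
    have -> : r = 0 by apply/eqP; move: (expf_eq0 r d);
      rewrite rE a0 eqxx hd => /esym.
    have [S SD cS] := max_card_face Dsc.
    rewrite add0r expr1n mulr1 ler_nat -Dd -cS -cards_draws.
    apply: subset_leq_card; apply/subsetP => T; rewrite !inE => /andP[TS ->].
    by rewrite andbT; case: Dsc => _; apply; first exact: SD.
  rewrite (flag_cliques Dflag); apply: (@nface_ge R F) => //.
  - exact: edge_sym.
  - by rewrite /nface -flag_cliques // card_faces_gt_max ?Dd.
  - by rewrite /dcyc -flag_cliques // -top_betti // Da.
  - by rewrite /dcyc -flag_cliques // -top_betti // Da rE.
have ma : a = (m ^ d)%N by apply/eqP; rewrite -(eqr_nat R) natrX -rm rE.
split.
  (* The extremal example is the complete [d]-partite graph with parts ['I_m.+1], coloured by the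
     first coordinate. *)
  pose V : finType := ('I_d * 'I_m.+1)%type.
  pose e : rel V := fun u v => u.1 != v.1.
  have e_sym : symmetric e by move=> u v; rewrite /e eq_sym.
  have tV : turan_coloring e setT d m (fun u => u.1 : nat).
    split=> [u _|u v _ _ _|j jd] //.
    rewrite -[RHS]card_ord -(card_imset (f := fun x : 'I_m.+1 =>
      (Ordinal jd, x))); last first.
      by move=> x y [].
    apply: eq_card => -[i x]; rewrite !inE /=;
      apply/eqP/imsetP => [ij|[y _ [-> _]] //].
    by exists x => //; congr pair; apply: val_inj.
  pose D := clique_complex e; exists V, D.
  have Dsc : simplicial_complex D by case: (flag_clique_complex e_sym).
  have DE i : #|faces D i| = nface e setT i.
    by rewrite /nface -clique_complex_setT.
  have Dd : Defs.max_card D = d.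
    apply: max_cardE => [|i di]; rewrite DE (nface_turan e_sym _ tV).
      by rewrite binn mul1n expn_gt0.
    by rewrite bin_small.
  split; [exact: flag_clique_complex | exact/complex_dimE | |]; last first.
    by rewrite /bound rm; apply: f_poly_turan tV DE.
  rewrite top_betti // /D clique_complex_setT -/(dcyc F e setT d) ma.
  apply/eqP; rewrite eqn_leq (dcyc_turan F e_sym tV) andbT.
  (* The converse of [dcyc_turan]: with [s^d] cycles, the linear coefficient in [nface_ge] gives
     [d (s + 1) <= d (m + 1)], so [s <= m]. *)
  have [->//|cpos] := posnP (dcyc F e setT d).
  have [s0 sE] := dcyc_root R cpos; set s := (_ `^ _) in s0 sE.
  have top0 : nface e setT d.+1 = 0%N
    by rewrite (nface_turan e_sym _ tV) bin_small.
  have sle : s ^+ d <= (dcyc F e setT d)%:R by rewrite sE.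
  have := nface_ge e_sym (ltW s0) top0 cpos sle 1.
  rewrite (nface_turan e_sym _ tV) bin1 expr1 expn1 natrM ler_pM2l ?ltr0n //.
  rewrite -natr1 lerD2r => sm.
  by rewrite -(ler_nat R) natrX -sE lerXn2r ?nnegrE ?ler0n ?(ltW s0).
move=> V D Dflag /complex_dimE Dd Da.
have Dsc : simplicial_complex D by case: Dflag.
split=> [fD|isoD]; last first.
  have sym_turan : symmetric (turan_graph d (d * m.+1)).
    by move=> i j; rewrite /turan_graph eq_sym.
  rewrite /bound rm; apply: (f_poly_turan R sym_turan (turan_graph_coloring m hd)) => i.
  by rewrite (card_faces_iso i Dsc isoD) clique_complex_setT.
suff [c tA] : exists c, turan_coloring (edge D) (vertices D) d m c.
  by rewrite (flag_cliques Dflag); apply: turan_coloring_iso tA.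
have cA : #|vertices D| = (d * m.+1)%N.
  apply/eqP; rewrite -(nface1 (@edge_sym _ D)) /nface -flag_cliques // -(eqr_nat R).
  by rewrite -coef_f_poly fD coef_affine_exp bin1 expr1 rm natr1 natrM.
(* For [m = 0] there are just [d] vertices, all in one face, so [D] is a simplex. *)
have [m0|m0] := posnP m.
  have [S SD cS] := max_card_face Dsc.
  have SV : S \subset vertices D.
    apply/subsetP => v vS; rewrite inE; case: Dsc => _; apply.
      exact: SD.
    by rewrite sub1set.
  have SE : S = vertices D by apply/eqP;
    rewrite eqEcard SV cA cS Dd m0 muln1 leqnn.
  have := @simplex_coloring V (edge D) (vertices D); rewrite cA m0 muln1 => sc.
  eexists; apply: sc => u v; rewrite -SE => uS vS _.
  by case: Dsc => _; apply; first exact: SD; rewrite subUset !sub1set uS.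
apply: (@extremal_coloring R F _ _ (@edge_sym _ D)) => //.
- by rewrite /nface -flag_cliques // card_faces_gt_max ?Dd.
- by rewrite /dcyc -flag_cliques // -top_betti // Da ma.
- by rewrite cA.
Qed.
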